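(* Let $A\to B\to C$ be a sequence of ring homomorphisms, and let $m\in\mathbb N\cup\{\infty\}$. If $C$ is formally étale over $B$, then the natural map $$\mathrm{HS}^m_{B/A}\otimes_B C \to \mathrm{HS}^m_{C/A}$$ is an isomorphism of graded $C$-algebras.
   Context: All rings and algebras are commutative with $1$; $\mathbb N$ contains $0$; when $m=\infty$, ''$i=1,\dots,m$'' means all positive integers $i$ (and ''$i=0,\dots,m$'' all $i\ge 0$). For a ring homomorphism $f\colon A\to B$, $\mathrm{HS}^m_{B/A}$ is the quotient of the polynomial algebra $B[x^{(i)}]_{x\in B,\ i=1,\dots,m}$ by the ideal generated by: $(x+y)^{(i)}-x^{(i)}-y^{(i)}$ for $x,y\in B$, $i=1,\dots,m$; $f(a)^{(i)}$ for $a\in A$, $i=1,\dots,m$; and $(xy)^{(k)}-\sum_{i+j=k}x^{(i)}y^{(j)}$ for $x,y\in B$, $k=0,\dots,m$, where $x^{(0)}$ is identified with $x$. Write $d_i x$ for the class of $x^{(i)}$ (so $d_0x=x$). $\mathrm{HS}^m_{B/A}$ is a graded $B$-algebra with $B$ in degree $0$ and $d_ix$ of degree $i$. The natural map $\mathrm{HS}^m_{B/A}\otimes_B C\to\mathrm{HS}^m_{C/A}$ is the $C$-algebra map sending $d_ib\otimes c$ to $c\,d_i(\bar b)$, where $\bar b$ is the image of $b$ in $C$. A $B$-algebra $C$ is formally unramified if for each $B$-algebra homomorphism $p\colon D\to E$ with nilpotent kernel and each $B$-algebra homomorphism $v\colon C\to E$ there is at most one $B$-algebra homomorphism $u\colon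 C\to D$ with $p\circ u=v$; it is formally smooth if for each surjective $B$-algebra homomorphism $p\colon D\to E$ with nilpotent kernel and each $B$-algebra homomorphism $v\colon C\to E$ there is at least one such $u$; it is formally étale if it is both formally unramified and formally smooth. *)

(* Defs.v *)
From HB Require Import structures.
From mathcomp Require Import all_boot all_order all_algebra.
From mathcomp Require Import finmap boolp monalg.

Set Implicit Arguments.
Unset Strict Implicit.
Unset Printing Implicit Defensive.

Import GRing.Theory.

Local Open Scope ring_scope.

(* Rings are [comPzRingType]s, so that the zero ring is included.  The
   libraries' [malg] and [ring_quotient] only provide ring structures for
   nonzero rings; [monoid_alg] and [quot_ring] lift this restriction. *)

(* [monoid_alg R op] is the monoid algebra over R of the commutative monoid
   (K, op, e); an element is a finitely supported family of coefficients. *)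
Section MonoidAlgebra.
Context (K : choiceType) (R : comPzRingType) (e : K) (op : Monoid.com_law e).

Definition monoid_alg (o : Monoid.com_law e) : Type := {malg R[K]}.
Local Notation MA := (monoid_alg op).

HB.instance Definition _ := GRing.Zmodule.on MA.

Implicit Types (g : {malg R[K]}).

Definition ma_one : {malg R[K]} := << 1 *g e >>.
Definition ma_mul g1 g2 : {malg R[K]} :=
  \sum_(k1 <- msupp g1) \sum_(k2 <- msupp g2)
     << g1@_k1 * g2@_k2 *g op k1 k2 >>.

Local Open Scope fset_scope.

Lemma ma_mulw (d1 d2 : {fset K}) g1 g2 :
  msupp g1 `<=` d1 -> msupp g2 `<=` d2 ->
  ma_mul g1 g2 = \sum_(k1 <- d1) \sum_(k2 <- d2)
                    << g1@_k1 * g2@_k2 *g op k1 k2 >>.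
Proof.
move=> le_d1 le_d2; rewrite /ma_mul (big_fset_incl _ le_d1) /=.
  apply/eq_bigr=> k1 _; apply/big_fset_incl => // k _ /mcoeff_outdom ->.
  by rewrite mulr0 monalgU0.
move=> k _ /mcoeff_outdom g1k.
by rewrite big1 => // k' _; rewrite g1k mul0r monalgU0.
Qed.

Lemma ma_mulC : commutative ma_mul.
Proof.
move=> g1 g2; rewrite /ma_mul exchange_big /=.
apply: eq_bigr => k1 _; apply: eq_bigr => k2 _.
by rewrite mulrC Monoid.mulmC.
Qed.

Lemma ma_mulUU c1 c2 k1 k2 :
  ma_mul << c1 *g k1 >> << c2 *g k2 >> = << c1 * c2 *g op k1 k2 >>.
Proof. by rewrite (ma_mulw msuppU_le msuppU_le) !big_seq_fset1 !mcoeffUU. Qed.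

Lemma ma_mulDl : left_distributive ma_mul +%R.
Proof.
move=> g1 g2 g.
have s1 : msupp g1 `<=` msupp g1 `|` msupp g2 by exact: fsubsetUl.
have s2 : msupp g2 `<=` msupp g1 `|` msupp g2 by exact: fsubsetUr.
rewrite (ma_mulw (msuppD_le _ _) (fsubset_refl _)).
rewrite (ma_mulw s1 (fsubset_refl _)) (ma_mulw s2 (fsubset_refl _)).
rewrite -big_split /=; apply/eq_bigr=> k1 _.
rewrite -big_split /=; apply/eq_bigr=> k2 _.
by rewrite mcoeffD mulrDl monalgUD.
Qed.

Lemma ma_mulDr : right_distributive ma_mul +%R.
Proof. by move=> g g1 g2; rewrite ma_mulC ma_mulDl !(ma_mulC g). Qed.

Lemma ma_mul0 : left_zero 0 ma_mul.
Proof. by move=> g; rewrite /ma_mul msupp0 big_seq_fset0. Qed.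

Lemma ma_mul0r : right_zero 0 ma_mul.
Proof. by move=> g; rewrite ma_mulC ma_mul0. Qed.

Lemma ma_suml I (r : seq I) (P : pred I) (F : I -> {malg R[K]}) g :
  ma_mul (\sum_(i <- r | P i) F i) g = \sum_(i <- r | P i) ma_mul (F i) g.
Proof.
exact: (big_morph (ma_mul^~ g) (fun _ _ => ma_mulDl _ _ _) (ma_mul0 g)).
Qed.

Lemma ma_sumr I (r : seq I) (P : pred I) (F : I -> {malg R[K]}) g :
  ma_mul g (\sum_(i <- r | P i) F i) = \sum_(i <- r | P i) ma_mul g (F i).
Proof. by rewrite ma_mulC ma_suml; apply: eq_bigr => i _; rewrite ma_mulC. Qed.

Lemma ma_mul1 : left_id ma_one ma_mul.
Proof.
move=> g; rewrite [in LHS](monalgE g) ma_sumr [RHS]monalgE.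
by apply/eq_bigr=> k _; rewrite ma_mulUU mul1r Monoid.mul1m.
Qed.

Lemma ma_mulA : associative ma_mul.
Proof.
move=> g1 g2 g3; rewrite (monalgE g1) !ma_suml; apply: eq_bigr => k1 _.
rewrite (monalgE g2) ma_suml !ma_sumr ma_suml; apply: eq_bigr => k2 _.
rewrite (monalgE g3) !ma_sumr; apply: eq_bigr => k3 _.
by rewrite !ma_mulUU mulrA Monoid.mulmA.
Qed.

HB.instance Definition _ :=
  GRing.Zmodule_isComPzRing.Build MA ma_mulA ma_mulC ma_mul1 ma_mulDl.

(* locked for the sake of unification *)
Fact ma_key : unit. Proof. exact: tt. Qed.

Definition ma_mon : K -> MA := locked_with ma_key (fun k => << 1 *g k >>).
Definition ma_const : R -> MA := locked_with ma_key (fun c => << c *g e >>).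

Lemma ma_monE k : ma_mon k = << 1 *g k >>.
Proof. by rewrite /ma_mon locked_withE. Qed.

Lemma ma_constE c : ma_const c = << c *g e >>.
Proof. by rewrite /ma_const locked_withE. Qed.

Lemma ma_const_additive : zmod_morphism ma_const.
Proof. by move=> x y; rewrite !ma_constE monalgUB. Qed.

Lemma ma_const_multiplicative : monoid_morphism ma_const.
Proof.
split=> [|x y]; rewrite !ma_constE //.
by rewrite -[RHS]/(ma_mul _ _) ma_mulUU Monoid.mul1m.
Qed.

HB.instance Definition _ :=
  GRing.isZmodMorphism.Build R MA ma_const ma_const_additive.
HB.instance Definition _ :=
  GRing.isMonoidMorphism.Build R MA ma_const ma_const_multiplicative.

End MonoidAlgebra.

Section MonoidAlgebraEval.
Context (K : choiceType) (e : K) (op : Monoid.com_law e).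
Context (R S : comPzRingType) (f : {rmorphism R -> S}) (h : K -> S).

Definition ma_eval (he : h e = 1) (hM : forall x y, h (op x y) = h x * h y)
    (g : monoid_alg R op) : S :=
  \sum_(k <- msupp (g : {malg R[K]})) f (mcoeff k g) * h k.

Hypotheses (he : h e = 1) (hM : forall x y, h (op x y) = h x * h y).
Local Notation ev := (ma_eval he hM).
Local Open Scope fset_scope.

Lemma ma_evalw (d : {fset K}) (g : {malg R[K]}) : msupp g `<=` d ->
  ev g = \sum_(k <- d) f (mcoeff k g) * h k.
Proof.
move=> le; rewrite /ma_eval (big_fset_incl _ le) => //= x xd /mcoeff_outdom ->.
by rewrite raddf0 mul0r.
Qed.

Lemma ma_evalU c k : ev (<< c *g k >> : {malg R[K]}) = f c * h k.
Proof. by rewrite (ma_evalw msuppU_le) big_seq_fset1 mcoeffUU. Qed.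

Lemma ma_eval_additive : zmod_morphism ev.
Proof.
move=> g1 g2; pose d := msupp (g1 : {malg R[K]}) `|` msupp (g2 : {malg R[K]}).
rewrite (@ma_evalw d) ?msuppB_le // (@ma_evalw d g1) ?fsubsetUl //.
rewrite (@ma_evalw d g2) ?fsubsetUr // -sumrB; apply: eq_bigr => k _.
by rewrite mcoeffB raddfB mulrBl.
Qed.

HB.instance Definition _ :=
  GRing.isZmodMorphism.Build (monoid_alg R op) S ev ma_eval_additive.

Lemma ma_eval_multiplicative : monoid_morphism ev.
Proof.
split=> [|g1 g2]; first by rewrite ma_evalU rmorph1 he mulr1.
rewrite -[g1 * g2]/(ma_mul op g1 g2) /ma_mul.
rewrite (raddf_sum ev) {2}/ma_eval mulr_suml; apply: eq_bigr => i _.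
rewrite (raddf_sum ev) {1}/ma_eval mulr_sumr; apply: eq_bigr => j _.
by rewrite /= ma_evalU rmorphM hM mulrACA.
Qed.

HB.instance Definition _ :=
  GRing.isMonoidMorphism.Build (monoid_alg R op) S ev ma_eval_multiplicative.

Lemma ma_eval_const c : ev (ma_const op c) = f c.
Proof. by rewrite ma_constE ma_evalU he mulr1. Qed.

Lemma ma_eval_mon k : ev (ma_mon R op k) = h k.
Proof. by rewrite ma_monE ma_evalU rmorph1 mul1r. Qed.

End MonoidAlgebraEval.

Section QuotientRing.
Context (R : comPzRingType) (S : R -> Prop).

Definition ideal_span : pred R := fun x =>
  `[< exists2 s : seq (R * R), (forall p, p \in s -> S p.2)
                              & x = \sum_(p <- s) p.1 * p.2 >].

Lemma ideal_spanM a x : x \in ideal_span -> a * x \in ideal_span.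
Proof.
move=> /asboolP[s hs ->]; apply/asboolP.
exists [seq (a * p.1, p.2) | p <- s].
  by move=> _ /mapP[p ps ->]; exact: (hs p).
by rewrite big_map mulr_sumr; apply: eq_bigr => p _; rewrite mulrA.
Qed.

Lemma ideal_span_zmod : zmod_closed ideal_span.
Proof.
split=> [|x y xI yI]; first by apply/asboolP; exists [::]; rewrite ?big_nil.
have /asboolP[t ht yE] := ideal_spanM (-1) yI; move: xI => /asboolP[s hs ->].
apply/asboolP; exists (s ++ t).
  by move=> p; rewrite mem_cat => /orP[/hs|/ht].
by rewrite big_cat /= -yE mulN1r.
Qed.

HB.instance Definition _ := GRing.isZmodClosed.Build R ideal_span ideal_span_zmod.

Lemma ideal_span_gen x : S x -> x \in ideal_span.
Proof.
move=> Sx; apply/asboolP; exists [:: (1, x)]; last by rewrite big_seq1 mul1r.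
by move=> p; rewrite inE => /eqP ->.
Qed.

Definition ideal : zmodClosed R := GRing.ZmodClosed.clone R ideal_span _.

Definition quot_ring : Type := Quotient.quot ideal.
HB.instance Definition _ := GRing.Zmodule.on quot_ring.

(* locked for the sake of unification *)
Fact qpi_key : unit. Proof. exact: tt. Qed.

Definition qpi : R -> quot_ring :=
  locked_with qpi_key (fun x => (\pi_(Quotient.quot ideal) x)%qT).

Lemma qpiE x : qpi x = (\pi_(Quotient.quot ideal) x)%qT.
Proof. by rewrite /qpi locked_withE. Qed.

Definition qrepr (x : quot_ring) : R :=
  repr (x : Quotient.quot ideal).

Lemma qreprK : cancel qrepr qpi. Proof. by move=> x; rewrite qpiE; exact: reprK. Qed.

Lemma qpiP x y : reflect (qpi x = qpi y) (x - y \in ideal_span).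
Proof. by rewrite Quotient.idealrBE !qpiE; exact: eqP. Qed.

Lemma qpi_additive : zmod_morphism qpi.
Proof. by move=> x y; rewrite !qpiE; exact: raddfB. Qed.

HB.instance Definition _ :=
  GRing.isZmodMorphism.Build R quot_ring qpi qpi_additive.

Lemma qpi_gen x : S x -> qpi x = 0.
Proof.
move=> /ideal_span_gen Sx; rewrite -(raddf0 qpi).
by apply/qpiP; rewrite subr0.
Qed.

Definition qone : quot_ring := qpi 1.
Definition qmul (x y : quot_ring) : quot_ring := qpi (qrepr x * qrepr y).

Lemma qpiM x y : qpi (x * y) = qmul (qpi x) (qpi y).
Proof.
apply/qpiP; set x' := qrepr _; set y' := qrepr _.
have -> : x * y - x' * y' = y * (x - x') + x' * (y - y').
  by rewrite !mulrBr (mulrC y x) (mulrC y x') subrKA.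
by rewrite rpredD // ideal_spanM //; apply/qpiP; rewrite qreprK.
Qed.

Lemma qmulA : associative qmul.
Proof.
move=> x y z; rewrite -[x]qreprK -[y]qreprK -[z]qreprK.
by rewrite -!qpiM mulrA.
Qed.
Lemma qmulC : commutative qmul.
Proof. by move=> x y; rewrite /qmul mulrC. Qed.
Lemma qmul1 : left_id qone qmul.
Proof. by move=> x; rewrite -[x]qreprK -qpiM mul1r. Qed.
Lemma qmulDl : left_distributive qmul +%R.
Proof.
move=> x y z; rewrite -[x]qreprK -[y]qreprK -[z]qreprK.
by rewrite -raddfD -!qpiM mulrDl raddfD.
Qed.

HB.instance Definition _ :=
  GRing.Zmodule_isComPzRing.Build quot_ring qmulA qmulC qmul1 qmulDl.

Lemma qpi_multiplicative : monoid_morphism qpi.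
Proof. by split=> // x y; exact: qpiM. Qed.

HB.instance Definition _ :=
  GRing.isMonoidMorphism.Build R quot_ring qpi qpi_multiplicative.

Section Lift.
Context (T : comPzRingType) (phi : {rmorphism R -> T}).

Definition qlift (phi0 : forall x, S x -> phi x = 0) (x : quot_ring) : T :=
  phi (qrepr x).

Hypothesis phi0 : forall x, S x -> phi x = 0.

Lemma qliftE x : qlift phi0 (qpi x) = phi x.
Proof.
apply/eqP; rewrite -subr_eq0 -rmorphB; apply/eqP.
have /asboolP[s hs ->] : qrepr (qpi x) - x \in ideal_span.
  by apply/qpiP; rewrite qreprK.
rewrite rmorph_sum big_seq big1 // => p /hs /phi0 p0.
by rewrite rmorphM p0 mulr0.
Qed.

Lemma qlift_additive : zmod_morphism (qlift phi0).
Proof.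
move=> x y; rewrite -[x]qreprK -[y]qreprK -rmorphB !qliftE.
exact: rmorphB.
Qed.

Lemma qlift_multiplicative : monoid_morphism (qlift phi0).
Proof.
split=> [|x y]; first by rewrite -[1]/(qpi 1) qliftE rmorph1.
by rewrite -[x]qreprK -[y]qreprK -rmorphM !qliftE rmorphM.
Qed.

HB.instance Definition _ :=
  GRing.isZmodMorphism.Build quot_ring T (qlift phi0) qlift_additive.
HB.instance Definition _ :=
  GRing.isMonoidMorphism.Build quot_ring T (qlift phi0) qlift_multiplicative.

End Lift.
End QuotientRing.

Arguments qpi : simpl never.
Arguments qlift : simpl never.
Arguments ma_eval : simpl never.

Definition poly_alg (R : comPzRingType) (V : choiceType) : comPzRingType :=
  monoid_alg R (@mmul {cmonom V}).

Section PolyEval.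
Context (R S : comPzRingType) (V : choiceType).
Context (f : {rmorphism R -> S}) (h : V -> S).

Definition mon_eval (k : {cmonom V}) : S := \prod_(v <- finsupp k) h v ^+ k v.

Local Open Scope fset_scope.

Lemma mon_evalw (d : {fset V}) (k : {cmonom V}) : finsupp k `<=` d ->
  mon_eval k = \prod_(v <- d) h v ^+ k v.
Proof.
move=> le; rewrite /mon_eval (big_fset_incl _ le) => //= v _.
by rewrite -cmE_eq0 => /eqP ->.
Qed.

Lemma mon_eval1 : mon_eval mone = 1.
Proof. by rewrite /mon_eval mdom1 big_seq_fset0. Qed.

Lemma mon_evalM x y : mon_eval (mmul x y) = mon_eval x * mon_eval y.
Proof.
rewrite (mon_evalw (fsubsetUl (finsupp x) (finsupp y))).
rewrite (mon_evalw (fsubsetUr (finsupp x) (finsupp y))).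
rewrite /mon_eval mdomD -big_split /=.
by apply: eq_bigr => v _; rewrite cmM exprD.
Qed.

Lemma mon_evalU v : mon_eval (ucm v) = h v.
Proof. by rewrite /mon_eval mdomU big_seq_fset1 cmUU. Qed.

Definition poly_eval : {rmorphism poly_alg R V -> S} :=
  ma_eval f mon_eval1 mon_evalM.

End PolyEval.

Section Tensor.
Context (B R C : comPzRingType).
Context (r : {rmorphism B -> R}) (g : {rmorphism B -> C}).

(* The free abelian group on R * C, with multiplication
   [(x, y)] * [(x', y')] = [(x * x', y * y')]. *)
Definition tensor_pre : comPzRingType :=
  monoid_alg int (@GRing.mul (R * C)%type).

Definition tensor_sym (x : R) (y : C) : tensor_pre :=
  ma_mon int (@GRing.mul (R * C)%type) (x, y).

Inductive tensor_rel : tensor_pre -> Prop :=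
| TensorDl x x' y : tensor_rel
    (tensor_sym (x + x') y - tensor_sym x y - tensor_sym x' y)
| TensorDr x y y' : tensor_rel
    (tensor_sym x (y + y') - tensor_sym x y - tensor_sym x y')
| TensorB b x y : tensor_rel
    (tensor_sym (r b * x) y - tensor_sym x (g b * y)).

(* R (x)_B C.  The bilinearity relations are stable under multiplication by
   the basis elements, so that the ideal they generate is the subgroup they
   generate. *)
Definition tensor : comPzRingType := quot_ring tensor_rel.

Definition tens (x : R) (y : C) : tensor := qpi tensor_rel (tensor_sym x y).

Lemma tensDl x x' y : tens (x + x') y = tens x y + tens x' y.
Proof.
apply/eqP; rewrite -subr_eq0 opprD addrA /tens -!rmorphB; apply/eqP.
exact/qpi_gen/TensorDl.
Qed.

Lemma tensDr x y y' : tens x (y + y') = tens x y + tens x y'.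
Proof.
apply/eqP; rewrite -subr_eq0 opprD addrA /tens -!rmorphB; apply/eqP.
exact/qpi_gen/TensorDr.
Qed.

Lemma tensB b x y : tens (r b * x) y = tens x (g b * y).
Proof.
apply/eqP; rewrite -subr_eq0 /tens -!rmorphB; apply/eqP.
exact/qpi_gen/TensorB.
Qed.

Lemma tensM x x' y y' : tens (x * x') (y * y') = tens x y * tens x' y'.
Proof.
rewrite /tens -rmorphM; congr qpi; rewrite /tensor_sym !ma_monE.
by rewrite -[RHS]/(ma_mul _ _ _) ma_mulUU mul1r.
Qed.

Lemma tens1 : tens 1 1 = 1.
Proof.
by rewrite /tens -[RHS](rmorph1 (qpi tensor_rel)) /tensor_sym ma_monE.
Qed.

Definition tensor_in (y : C) : tensor := tens 1 y.

Lemma tensor_in_additive : zmod_morphism tensor_in.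
Proof.
move=> x y; apply/eqP; rewrite eq_sym subr_eq /tensor_in -tensDr.
by rewrite subrK.
Qed.

Lemma tensor_in_multiplicative : monoid_morphism tensor_in.
Proof. by split=> [|x y]; rewrite /tensor_in ?tens1 // -tensM mul1r. Qed.

HB.instance Definition _ :=
  GRing.isZmodMorphism.Build C tensor tensor_in tensor_in_additive.
HB.instance Definition _ :=
  GRing.isMonoidMorphism.Build C tensor tensor_in tensor_in_multiplicative.

(* G is a grading of R; C is in degree 0. *)
Definition tensor_deg (G : nat -> R -> Prop) (n : nat) (t : tensor) : Prop :=
  exists2 s : seq (R * C), (forall q, q \in s -> G n q.1)
                         & t = \sum_(q <- s) tens q.1 q.2.

Section Lift.
Context (S : comPzRingType) (F : {rmorphism R -> S}) (G : {rmorphism C -> S}).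
Hypothesis FG : forall b, F (r b) = G (g b).

Let h (q : R * C) : S := F q.1 * G q.2.

Fact tensor_lift_h1 : h 1 = 1.
Proof. by rewrite /h !rmorph1 mulr1. Qed.

Fact tensor_lift_hM x y : h (x * y) = h x * h y.
Proof. by rewrite /h !rmorphM mulrACA. Qed.

Definition tensor_pre_lift : {rmorphism tensor_pre -> S} :=
  @ma_eval _ _ (@GRing.mul (R * C)%type) _ _ (intmul 1 : {rmorphism int -> S}) h
    tensor_lift_h1 tensor_lift_hM.

Lemma tensor_pre_liftE x y : tensor_pre_lift (tensor_sym x y) = F x * G y.
Proof. exact: ma_eval_mon. Qed.

Fact tensor_lift0 x : tensor_rel x -> tensor_pre_lift x = 0.
Proof.
case=> [{}x x' y|{}x y y'|b {}x y].
- rewrite rmorphB rmorphB !tensor_pre_liftE rmorphD mulrDl -addrA -opprD.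
  by rewrite subrr.
- rewrite rmorphB rmorphB !tensor_pre_liftE rmorphD mulrDr -addrA -opprD.
  by rewrite subrr.
- by rewrite rmorphB !tensor_pre_liftE !rmorphM FG mulrCA mulrA subrr.
Qed.

Definition tensor_lift : {rmorphism tensor -> S} := qlift tensor_lift0.

Lemma tensor_liftE x y : tensor_lift (tens x y) = F x * G y.
Proof. by rewrite -tensor_pre_liftE -(qliftE tensor_lift0). Qed.

End Lift.
End Tensor.

(* [None] stands for m = oo. *)
Definition le_ext (i : nat) (m : option nat) : bool :=
  if m is Some n then (i <= n)%N else true.

Section HasseSchmidt.
Context (A B : comPzRingType) (f : {rmorphism A -> B}) (m : option nat).

Definition hs_index := {i : nat | (0 < i)%N && le_ext i m}.
Definition hs_var : Type := (B * hs_index)%type.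
HB.instance Definition _ := Choice.on hs_var.

Definition hs_poly : comPzRingType := poly_alg B hs_var.

(* x^(i), for 0 <= i <= m; x^(0) is the constant x.  The value 0 for i > m is
   never used. *)
Definition hs_sym (x : B) (i : nat) : hs_poly :=
  if i == 0%N then ma_const _ x
  else oapp (fun j : hs_index => ma_mon B _ (ucm (x, j))) 0 (insub i).

Inductive hs_rel : hs_poly -> Prop :=
| HsAdd x y i : (0 < i)%N -> le_ext i m ->
    hs_rel (hs_sym (x + y) i - hs_sym x i - hs_sym y i)
| HsBase a i : (0 < i)%N -> le_ext i m -> hs_rel (hs_sym (f a) i)
| HsMul x y k : le_ext k m ->
    hs_rel (hs_sym (x * y) k
            - \sum_(i < k.+1) hs_sym x i * hs_sym y (k - i)).

Definition HS : comPzRingType := quot_ring hs_rel.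

Definition hs_in : {rmorphism B -> HS} := qpi hs_rel \o ma_const _.

Definition hs_d (i : nat) (x : B) : HS := qpi hs_rel (hs_sym x i).

Definition hs_weight (k : {cmonom hs_var}) : nat :=
  (\sum_(v <- finsupp k) k v * val v.2)%N.

Definition hs_deg (n : nat) (h : HS) : Prop :=
  exists2 p : hs_poly,
    (forall k, k \in msupp (p : {malg B[{cmonom hs_var}]}) -> hs_weight k = n)
    & h = qpi hs_rel p.

Section Lift.
Context (S : comPzRingType) (F : {rmorphism B -> S}) (D : nat -> B -> S).
Hypothesis D0 : forall x, D 0 x = F x.
Hypothesis DD : forall x y i, (0 < i)%N -> le_ext i m ->
  D i (x + y) = D i x + D i y.
Hypothesis DA : forall a i, (0 < i)%N -> le_ext i m -> D i (f a) = 0.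
Hypothesis DM : forall x y k, le_ext k m ->
  D k (x * y) = \sum_(i < k.+1) D i x * D (k - i) y.

Definition hs_pre_lift : {rmorphism hs_poly -> S} :=
  poly_eval F (fun v : hs_var => D (val v.2) v.1).

Lemma hs_pre_liftE x i : le_ext i m -> hs_pre_lift (hs_sym x i) = D i x.
Proof.
move=> im; rewrite /hs_sym; have [->|i0] := eqVneq i 0%N.
  by rewrite /hs_pre_lift /= ma_eval_const D0.
rewrite insubT ?lt0n ?i0 //= => ?.
by rewrite /hs_pre_lift /= ma_eval_mon mon_evalU.
Qed.

Lemma le_ext_trans i k : (i <= k)%N -> le_ext k m -> le_ext i m.
Proof. by case: m => //= n; exact: leq_trans. Qed.

Fact hs_lift0 p : hs_rel p -> hs_pre_lift p = 0.
Proof.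
case=> [x y i i0 im|a i i0 im|x y k km].
- by rewrite rmorphB rmorphB !hs_pre_liftE // DD // -addrA -opprD subrr.
- by rewrite hs_pre_liftE // DA.
- rewrite rmorphB rmorph_sum hs_pre_liftE // DM //; apply/eqP.
  rewrite subr_eq0; apply/eqP; apply: eq_bigr => i _.
  rewrite rmorphM !hs_pre_liftE //; apply: (le_ext_trans _ km).
    exact: leq_subr.
  by rewrite -ltnS.
Qed.

Definition hs_lift : {rmorphism HS -> S} := qlift hs_lift0.

Lemma hs_lift_d i x : le_ext i m -> hs_lift (hs_d i x) = D i x.
Proof. by move=> im; rewrite -(hs_pre_liftE x im) -(qliftE hs_lift0). Qed.

Lemma hs_lift_in x : hs_lift (hs_in x) = F x.
Proof. by rewrite -D0 -hs_lift_d //; case: m. Qed.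

End Lift.

Lemma hs_d0 x : hs_d 0 x = hs_in x.
Proof. by []. Qed.

Lemma hs_dD x y i : le_ext i m -> hs_d i (x + y) = hs_d i x + hs_d i y.
Proof.
move=> im; have [->|i0] := posnP i; first by rewrite !hs_d0 rmorphD.
apply/eqP; rewrite -subr_eq0 opprD addrA /hs_d -!rmorphB; apply/eqP.
by apply/qpi_gen/HsAdd.
Qed.

Lemma hs_dA a i : (0 < i)%N -> le_ext i m -> hs_d i (f a) = 0.
Proof. by move=> i0 im; apply/qpi_gen/HsBase. Qed.

Lemma hs_dM x y k : le_ext k m ->
  hs_d k (x * y) = \sum_(i < k.+1) hs_d i x * hs_d (k - i) y.
Proof.
move=> km; apply/eqP; rewrite -subr_eq0 /hs_d; apply/eqP.
under eq_bigr do rewrite -rmorphM.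
by rewrite -rmorph_sum -rmorphB; apply/qpi_gen/HsMul.
Qed.

End HasseSchmidt.

Section NaturalMap.
Context (A B C : comPzRingType).
Context (f : {rmorphism A -> B}) (g : {rmorphism B -> C}) (m : option nat).

Definition comp_rmorphism : {rmorphism A -> C} := g \o f.

Local Notation D := (fun i (x : B) => hs_d comp_rmorphism m i (g x)).

Fact hs_map_D0 x : D 0%N x = (hs_in comp_rmorphism m \o g) x.
Proof. by []. Qed.
Fact hs_map_DD x y i : (0 < i)%N -> le_ext i m -> D i (x + y) = D i x + D i y.
Proof. by move=> _ im; rewrite /= rmorphD hs_dD. Qed.
Fact hs_map_DA a i : (0 < i)%N -> le_ext i m -> D i (f a) = 0.
Proof. exact: (@hs_dA _ _ comp_rmorphism). Qed.
Fact hs_map_DM x y k : le_ext k m ->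
  D k (x * y) = \sum_(i < k.+1) D i x * D (k - i)%N y.
Proof. by move=> km; rewrite /= rmorphM hs_dM. Qed.

Definition hs_map : {rmorphism HS f m -> HS comp_rmorphism m} :=
  hs_lift hs_map_D0 hs_map_DD hs_map_DA hs_map_DM.

Fact hs_map_in b : hs_map (hs_in f m b) = hs_in comp_rmorphism m (g b).
Proof. exact: hs_lift_in. Qed.

Definition natural_map :
    {rmorphism tensor (hs_in f m) g -> HS comp_rmorphism m} :=
  tensor_lift hs_map_in.

Lemma hs_map_d i b : le_ext i m ->
  hs_map (hs_d f m i b) = hs_d comp_rmorphism m i (g b).
Proof. exact: hs_lift_d. Qed.

Lemma natural_mapE i b c : le_ext i m ->
  natural_map (tens (hs_in f m) g (hs_d f m i b) c)
  = hs_in comp_rmorphism m c * hs_d comp_rmorphism m i (g b).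
Proof.
move=> im; rewrite mulrC -(hs_map_d b im).
exact: (tensor_liftE hs_map_in).
Qed.

End NaturalMap.

(* iS, iT are the structure maps, GS n, GT n the homogeneous parts of degree n. *)
Definition graded_alg_iso (C S T : comPzRingType)
    (iS : {rmorphism C -> S}) (GS : nat -> S -> Prop)
    (iT : {rmorphism C -> T}) (GT : nat -> T -> Prop)
    (phi : {rmorphism S -> T}) : Prop :=
  [/\ bijective phi,
      forall c, phi (iS c) = iT c
    & forall n x, GS n x <-> GT n (phi x)].

(* The ideal I = ker p satisfies I ^ n = 0 for some n; it is enough to say so
   for the products of n elements of I, which generate I ^ n. *)
Definition nilpotent_kernel (D E : comPzRingType) (p : {rmorphism D -> E}) :=
  exists n : nat, forall x : 'I_n -> D,
    (forall i, p (x i) = 0) -> \prod_(i < n) x i = 0.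

(* In what follows a B-algebra is a ring with a homomorphism from B, and a
   B-algebra homomorphism is a ring homomorphism compatible with these. *)
Definition alg_hom (B D E : comPzRingType) (d : {rmorphism B -> D})
    (e : {rmorphism B -> E}) (u : {rmorphism D -> E}) : Prop :=
  forall b, u (d b) = e b.

Definition formally_unramified (B C : comPzRingType) (g : {rmorphism B -> C}) :
    Prop :=
  forall (D E : comPzRingType) (d : {rmorphism B -> D}) (e : {rmorphism B -> E})
    (p : {rmorphism D -> E}), alg_hom d e p -> nilpotent_kernel p ->
  forall v : {rmorphism C -> E}, alg_hom g e v ->
  forall u1 u2 : {rmorphism C -> D}, alg_hom g d u1 -> alg_hom g d u2 ->
    p \o u1 =1 v -> p \o u2 =1 v -> u1 =1 u2.

Definition formally_smooth (B C : comPzRingType) (g : {rmorphism B -> C}) :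
    Prop :=
  forall (D E : comPzRingType) (d : {rmorphism B -> D}) (e : {rmorphism B -> E})
    (p : {rmorphism D -> E}), alg_hom d e p ->
    (forall y, exists x, p x = y) -> nilpotent_kernel p ->
  forall v : {rmorphism C -> E}, alg_hom g e v ->
  exists2 u : {rmorphism C -> D}, alg_hom g d u & p \o u =1 v.

Definition formally_etale (B C : comPzRingType) (g : {rmorphism B -> C}) :
    Prop :=
  formally_unramified g /\ formally_smooth g.

(* Main.v *)
Require Import Defs.
From HB Require Import structures.
From mathcomp Require Import all_boot all_order all_algebra.
From mathcomp Require Import finmap boolp monalg.

Set Implicit Arguments.
Unset Strict Implicit.
Unset Printing Implicit Defensive.

Import GRing.Theory.

Local Open Scope ring_scope.

(** A higher derivation of length n from a ring X to a ring S is the same thing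
    as a ring homomorphism X -> S[t]/(t^(n+1)), namely
    x |-> sum_i D_i(x) t^i, and the constant-coefficient map
    S[t]/(t^(n+1)) -> S has nilpotent kernel.  The infinitesimal lifting
    property of a formally etale B-algebra C therefore says that a higher
    derivation of B extends uniquely to C, once its component D_0 has been
    extended ([higher_derivation_unique], [higher_derivation_extend]).  When
    the length m is infinite, the kernel of S[[t]] -> S is no longer
    nilpotent; one extends to each finite length, and uniqueness makes the
    extensions compatible.

    Let T be the tensor product of HS_{B/A} and C over B.  The universal higher
    derivation of B, followed by the map HS_{B/A} -> T, extends to a higher
    derivation D of C with values in T.  It vanishes on A in positive degrees,
    so the universal property of HS_{C/A} turns it into a ring homomorphism
    psi : HS_{C/A} -> T.  That psi is a left inverse of the natural map phi is
    checked on generators, where D extends the derivation of B.  For the other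
    composite, phi o D and the universal higher derivation of C are two
    extensions of the same higher derivation of B, hence equal.

    The natural map visibly preserves degrees.  For psi to do so, D_i must take
    its values in the degree i part of T.  This is obtained by lifting not to
    all truncated series but to the subring of those whose i-th coefficient is
    homogeneous of degree i; see [graded_series]. *)

(** * Truncated power series *)

Section Convolution.
Context (R : comPzRingType).
Implicit Types (a b c : nat -> R) (k : nat).

Definition conv a b k : R := \sum_(i < k.+1) a i * b (k - i)%N.

Lemma eq_conv a a' b b' k :
    (forall i, (i <= k)%N -> a i = a' i) ->
    (forall i, (i <= k)%N -> b i = b' i) ->
  conv a b k = conv a' b' k.
Proof.
move=> ea eb; apply: eq_bigr => i _.
by rewrite ea ?leq_ord // eb ?leq_subr.
Qed.

Lemma convC a b k : conv a b k = conv b a k.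
Proof.
rewrite /conv (reindex_inj rev_ord_inj) /=.
by apply: eq_bigr => i _; rewrite subSS sub_ordK mulrC.
Qed.

(** Both sides are the sum of a_i b_j c_l over i + j + l = k; the middle step
    exchanges the order of summation over the triangle j + l <= k. *)
Lemma convA a b c k : conv a (conv b c) k = conv (conv a b) c k.
Proof.
rewrite [RHS]convC.
pose t j l := a j * b (k - j - l)%N * c l.
transitivity (\sum_(j < k.+1) \sum_(l < k.+1 | (l <= k - j)%N) t j l).
  apply: eq_bigr => /= j _; rewrite convC /conv mulr_sumr /=.
  rewrite (big_ord_narrow_leq (leq_subr _ _)); apply: eq_bigr => l _ /=.
  by rewrite /t -mulrA [c l * _]mulrC.
rewrite (exchange_big_dep predT) //=; apply: eq_bigr => l _.
transitivity (\sum_(j < k.+1 | (j <= k - l)%N) t j l).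
  apply: eq_bigl => j; rewrite -ltnS -(ltnS j) -!subSn ?leq_ord //.
  by rewrite -subn_gt0 -(subn_gt0 j) -!subnDA addnC.
rewrite (big_ord_narrow_leq (leq_subr _ _)) /conv mulr_sumr.
by apply: eq_bigr => j _; rewrite /t -!subnDA addnC mulrC.
Qed.

Lemma conv_lead a b : conv a b 0 = a 0%N * b 0%N.
Proof. by rewrite /conv big_ord1. Qed.

Lemma conv1 a k : conv (fun i => (i == 0)%:R) a k = a k.
Proof.
rewrite /conv big_ord_recl mul1r subn0 big1 ?addr0 // => i _.
by rewrite mul0r.
Qed.

End Convolution.

Section TruncatedSeries.
Context (R : comPzRingType) (n : nat).

(** The ring R[t]/(t^(n+1)), for a possibly zero R. *)
Definition tps : Type := {ffun 'I_n.+1 -> R}.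
HB.instance Definition _ := GRing.Zmodule.on tps.

Implicit Types (a b c : tps).

Definition coeft a (i : nat) : R := (a : {ffun _}) (inord i).
Definition mk_tps (F : nat -> R) : tps := [ffun i : 'I_n.+1 => F i].

Lemma coeftK F i : (i <= n)%N -> coeft (mk_tps F) i = F i.
Proof. by move=> le; rewrite /coeft ffunE inordK. Qed.

Lemma tpsP a b : (forall i, (i <= n)%N -> coeft a i = coeft b i) -> a = b.
Proof.
move=> ab; apply/ffunP => i.
by move: (ab i (leq_ord i)); rewrite /coeft inord_val.
Qed.

Lemma coeftB a b i : coeft (a - b) i = coeft a i - coeft b i.
Proof. by rewrite /coeft !ffunE. Qed.

Lemma coeftD a b i : coeft (a + b) i = coeft a i + coeft b i.
Proof. by rewrite /coeft !ffunE. Qed.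

Definition tps_one : tps := mk_tps (fun i => (i == 0)%:R).
Definition tps_mul a b : tps := mk_tps (conv (coeft a) (coeft b)).

Lemma coeft_mul a b k : (k <= n)%N ->
  coeft (tps_mul a b) k = conv (coeft a) (coeft b) k.
Proof. exact: coeftK. Qed.

Lemma tps_mulC : commutative tps_mul.
Proof. by move=> a b; apply: tpsP => k kn; rewrite !coeft_mul // convC. Qed.

Lemma tps_mulA : associative tps_mul.
Proof.
move=> a b c; apply: tpsP => k kn; rewrite !coeft_mul //.
rewrite (eq_conv (a' := coeft a) (b' := conv (coeft b) (coeft c))) //.
  rewrite convA; apply: eq_conv => // i ik.
  by rewrite coeft_mul // (leq_trans ik).
by move=> i ik; rewrite coeft_mul // (leq_trans ik).
Qed.

Lemma tps_mul1 : left_id tps_one tps_mul.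
Proof.
move=> a; apply: tpsP => k kn; rewrite coeft_mul //.
rewrite -[RHS](conv1 (coeft a)).
by apply: eq_conv => // i ik; rewrite coeftK // (leq_trans ik).
Qed.

Lemma tps_mulDl : left_distributive tps_mul +%R.
Proof.
move=> a b c; apply: tpsP => k kn; rewrite coeftD !coeft_mul //.
by rewrite -big_split; apply: eq_bigr => i _; rewrite coeftD mulrDl.
Qed.

HB.instance Definition _ :=
  GRing.Zmodule_isComPzRing.Build tps tps_mulA tps_mulC tps_mul1 tps_mulDl.

Lemma coeft1 k : (k <= n)%N -> coeft 1 k = (k == 0)%:R.
Proof. exact: coeftK. Qed.

Lemma coeftM a b k : (k <= n)%N ->
  coeft (a * b) k = conv (coeft a) (coeft b) k.
Proof. exact: coeft_mul. Qed.

Definition coeft0 a : R := coeft a 0.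

Lemma coeft0_additive : zmod_morphism coeft0.
Proof. by move=> a b; exact: coeftB. Qed.

Lemma coeft0_multiplicative : monoid_morphism coeft0.
Proof.
split=> [|a b]; first by rewrite /coeft0 coeft1.
by rewrite /coeft0 coeftM // conv_lead.
Qed.

HB.instance Definition _ :=
  GRing.isZmodMorphism.Build tps R coeft0 coeft0_additive.
HB.instance Definition _ :=
  GRing.isMonoidMorphism.Build tps R coeft0 coeft0_multiplicative.

(** Each factor without constant term contributes a factor t; for k = n + 1 this
    is the nilpotency of the kernel of [coeft0]. *)
Lemma prod_coeft_eq0 k (x : 'I_k -> tps) j :
    (forall i, coeft (x i) 0 = 0) -> (j < k)%N -> (j <= n)%N ->
  coeft (\prod_(i < k) x i) j = 0.
Proof.
elim: k x j => // k IHk x j x0 jk jn.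
rewrite big_ord_recl coeftM // /conv big_ord_recl x0 mul0r add0r.
rewrite big1 // => i _; rewrite IHk ?mulr0 //.
  apply: leq_trans (jk : (j <= k)%N).
  by rewrite ltn_subrL lift0 /= (leq_trans _ (ltn_ord i)).
exact: leq_trans (leq_subr _ _) jn.
Qed.

Lemma prod_tps_eq0 (x : 'I_n.+1 -> tps) :
  (forall i, coeft (x i) 0 = 0) -> \prod_(i < n.+1) x i = 0.
Proof.
move=> x0; apply: tpsP => j jn; rewrite prod_coeft_eq0 //.
by rewrite /coeft ffunE.
Qed.

Lemma coeft0_nilpotent : nilpotent_kernel coeft0.
Proof. by exists n.+1; exact: prod_tps_eq0. Qed.

End TruncatedSeries.

(** * Higher derivations as homomorphisms into truncated power series *)

Definition higher_derivation (X S : comPzRingType) (m : option nat)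
    (F : X -> S) (D : nat -> X -> S) : Prop :=
  [/\ forall x, D 0%N x = F x,
      forall i, le_ext i m -> forall x y, D i (x + y) = D i x + D i y
    & forall k, le_ext k m -> forall x y,
        D k (x * y) = conv (D^~ x) (D^~ y) k].

Lemma higher_derivation_le (X S : comPzRingType) m n (F : X -> S) D :
  le_ext n m -> higher_derivation m F D -> higher_derivation (Some n) F D.
Proof.
move=> nm [D0 DD DM]; split=> // i /= ile x y.
  by rewrite DD // (le_ext_trans ile).
by rewrite DM // (le_ext_trans ile).
Qed.

Lemma higher_derivation_comp (X S T : comPzRingType) m (F : X -> S) D
    (phi : {rmorphism S -> T}) :
  higher_derivation m F D ->
  higher_derivation m (phi \o F) (fun i => phi \o D i).
Proof.
case=> D0 DD DM; split=> [x|i im x y|k km x y] /=.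
- by rewrite D0.
- by rewrite DD // rmorphD.
- rewrite DM // rmorph_sum; apply: eq_bigr => i _.
  by rewrite rmorphM.
Qed.

Section Taylor.
Context (X S : comPzRingType) (n : nat).
Context (F : {rmorphism X -> S}) (D : nat -> X -> S).

(** The proof is an argument of the function so that the ring homomorphism
    structure below can be attached to it. *)
Definition taylor (hD : higher_derivation (Some n) F D) (x : X) : tps S n :=
  mk_tps n (D^~ x).

Hypothesis hD : higher_derivation (Some n) F D.

Lemma coeft_taylor x i : (i <= n)%N -> coeft (taylor hD x) i = D i x.
Proof. exact: coeftK. Qed.

(** Expanding D_i(1 * 1) = 2 D_i(1) + (terms that vanish by induction) gives
    D_i(1) = 0 for i > 0. *)
Lemma higher_derivation1 i : (i <= n)%N -> D i 1 = (i == 0)%:R.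
Proof.
have [D0 DD DM] := hD.
elim/ltn_ind: i => -[|i] IHi le; first by rewrite D0 rmorph1.
have := DM i.+1 le 1 1.
rewrite mulr1 /conv big_ord_recl big_ord_recr /= !subn0 D0 rmorph1 mul1r.
rewrite subnn D0 rmorph1 mulr1 big1 => [|j _].
  by rewrite add0r -[X in X = _]addr0 => /addrI/esym.
rewrite (IHi (bump 0 j)) ?mul0r //.
  by rewrite ltnS; exact: ltn_ord.
by rewrite (leq_trans _ le) // ltnW // ltnS; exact: ltn_ord.
Qed.

Lemma taylor_additive : zmod_morphism (taylor hD).
Proof.
have [D0 DD DM] := hD; move=> x y; apply: tpsP => i le.
rewrite coeftB !coeft_taylor //; apply/eqP.
by rewrite eq_sym subr_eq -DD // subrK.
Qed.

Lemma taylor_multiplicative : monoid_morphism (taylor hD).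
Proof.
have [D0 DD DM] := hD; split=> [|x y]; apply: tpsP => i le.
  by rewrite coeft_taylor // coeft1 // higher_derivation1.
rewrite coeftM // coeft_taylor // DM //; apply: eq_conv => j ji;
  by rewrite coeft_taylor // (leq_trans ji).
Qed.

HB.instance Definition _ :=
  GRing.isZmodMorphism.Build X (tps S n) (taylor hD) taylor_additive.
HB.instance Definition _ :=
  GRing.isMonoidMorphism.Build X (tps S n) (taylor hD) taylor_multiplicative.

End Taylor.

Lemma higher_derivation_coeft (X S : comPzRingType) n
    (u : {rmorphism X -> tps S n}) (F : X -> S) :
    (forall x, coeft (u x) 0 = F x) ->
  higher_derivation (Some n) F (fun i x => coeft (u x) i).
Proof.
move=> u0; split=> // [i _ x y|k kn x y].
  by rewrite rmorphD coeftD.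
by rewrite rmorphM coeftM.
Qed.

(** The Taylor homomorphisms of D and D' are two liftings of F along
    S[t]/(t^(n+1)) -> S over B, where S[t]/(t^(n+1)) is a B-algebra through
    their common restriction to B. *)
Lemma higher_derivation_unique (B C S : comPzRingType) (g : {rmorphism B -> C})
    m (F : {rmorphism C -> S}) (D D' : nat -> C -> S) :
    formally_unramified g ->
    higher_derivation m F D -> higher_derivation m F D' ->
    (forall i b, le_ext i m -> D i (g b) = D' i (g b)) ->
  forall i c, le_ext i m -> D i c = D' i c.
Proof.
move=> unr hD hD' eqB n c nm.
have hDn := higher_derivation_le nm hD.
have hDn' := higher_derivation_le nm hD'.
have [D0 _ _] := hDn; have [D0' _ _] := hDn'.
rewrite -(coeft_taylor hDn) // -(coeft_taylor hDn' c) //.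
suff -> : taylor hDn c = taylor hDn' c by [].
pose d : {rmorphism B -> tps S n} := taylor hDn \o g.
pose p : {rmorphism tps S n -> S} := @coeft0 S n.
apply: (unr _ _ d (p \o d) p _ (coeft0_nilpotent S n) F) => //.
- by move=> b; rewrite /= /coeft0 coeft_taylor // D0.
- move=> b; apply: tpsP => i le.
  by rewrite !coeft_taylor // eqB // (le_ext_trans le).
- by move=> x; rewrite /= /coeft0 coeft_taylor // D0.
- by move=> x; rewrite /= /coeft0 coeft_taylor // D0'.
Qed.

(** Closure under the ring operations is all that is recorded.  In this form a
    grading of R induces one on a tensor product over a degree 0 subring, whose
    parts are given by spanning sets, without any direct sum decomposition. *)
Record gradation (S : comPzRingType) := Gradation {
  part :> nat -> S -> Prop;
  part0 : forall n, part n 0;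
  partB : forall n x y, part n x -> part n y -> part n (x - y);
  part1 : part 0 1;
  partM : forall i j x y, part i x -> part j y -> part (i + j) (x * y) }.

Section Gradation.
Context (S : comPzRingType) (G : gradation S).

Lemma partD n x y : G n x -> G n y -> G n (x + y).
Proof.
move=> Gx Gy; rewrite -[y]opprK; apply: (partB Gx).
by rewrite -sub0r; apply: partB => //; exact: part0.
Qed.

Lemma part_sum n (I : eqType) (r : seq I) (P : pred I) (F : I -> S) :
  (forall i, i \in r -> P i -> G n (F i)) -> G n (\sum_(i <- r | P i) F i).
Proof.
move=> GF; rewrite big_seq_cond; apply: big_ind => [|x y|i /andP[]].
- exact: part0.
- exact: partD.
- exact: GF.
Qed.

Lemma part_prod (I : Type) (r : seq I) (F : I -> S) (w : I -> nat) :
  (forall i, G (w i) (F i)) -> G (\sum_(i <- r) w i)%N (\prod_(i <- r) F i).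
Proof.
move=> GF; apply: (big_ind2 (fun n x => G n x)) => //.
  exact: part1.
by move=> n x k y; exact: partM.
Qed.

Lemma partX n x k : G n x -> G (k * n)%N (x ^+ k).
Proof.
move=> Gx; elim: k => [|k IHk]; first by rewrite expr0; exact: part1.
by rewrite exprS mulSn; exact: partM.
Qed.

Lemma part_conv a b k :
    (forall i, (i <= k)%N -> G i (a i)) ->
    (forall i, (i <= k)%N -> G i (b i)) ->
  G k (conv a b k).
Proof.
move=> Ga Gb; apply: part_sum => i _ _.
rewrite -[k in G k](subnKC (leq_ord i)).
by apply: partM; [apply: Ga; rewrite leq_ord | apply: Gb; rewrite leq_subr].
Qed.

End Gradation.

Section GradedSeries.
Context (C S : comPzRingType) (iota : {rmorphism C -> S}).
Context (G : gradation S) (n : nat).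

(** Pairs of an element c of C and a series with constant term iota(c) and i-th
    coefficient in degree i.  Lifting the identity of C along the projection to
    C yields series with homogeneous coefficients; keeping c in the pair makes
    that projection surjective with nilpotent kernel, without iota having to be
    injective or the degree 0 part to be made into a ring. *)
Definition graded_series : pred (C * tps S n) := fun x =>
  `[< coeft x.2 0 = iota x.1 /\
      forall i, (i <= n)%N -> G i (coeft x.2 i) >].

Lemma graded_series_subring : subring_closed graded_series.
Proof.
split=> [|x y /asboolP[x0 Gx] /asboolP[y0 Gy]|x y /asboolP[x0 Gx] /asboolP[y0 Gy]];
  apply/asboolP; split=> [|i le] /=.
- by rewrite coeft1 //= (rmorph1 iota).
- by rewrite coeft1 //; case: eqP => [->|_]; [exact: part1|exact: part0].
- by rewrite coeftB x0 y0 rmorphB.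
- by rewrite coeftB; apply: partB; [exact: Gx|exact: Gy].
- by rewrite coeftM // conv_lead x0 y0 rmorphM.
- rewrite coeftM //; apply: part_conv => j ji.
    by apply: Gx; rewrite (leq_trans ji).
  by apply: Gy; rewrite (leq_trans ji).
Qed.

Record gseries := GSeries {
  gseries_val :> C * tps S n; gseriesP : gseries_val \in graded_series }.
HB.instance Definition _ := [isSub for gseries_val].
HB.instance Definition _ := [Choice of gseries by <:].
HB.instance Definition _ := GRing.SubChoice_isSubComPzRing.Build
  (C * tps S n)%type graded_series gseries graded_series_subring.

Definition gseries_base : {rmorphism gseries -> C} := fst \o val.
Definition gseries_tps : {rmorphism gseries -> tps S n} := snd \o val.

Lemma coeft_gseries0 (x : gseries) :
  coeft (gseries_tps x) 0 = iota (gseries_base x).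
Proof. by have /asboolP[] := gseriesP x. Qed.

Lemma part_gseries (x : gseries) i : (i <= n)%N -> G i (coeft (gseries_tps x) i).
Proof. by have /asboolP[_] := gseriesP x; exact. Qed.

Lemma gseries_base_surj :
  (forall c, G 0 (iota c)) -> forall c, exists x, gseries_base x = c.
Proof.
move=> Giota c; pose s := mk_tps n (fun i => if i == 0 then iota c else 0).
suff cs : (c, s) \in graded_series by exists (GSeries cs).
apply/asboolP; split=> [|i le] /=; rewrite coeftK //.
by case: eqP => [->|_]; [exact: Giota|exact: part0].
Qed.

(** A series in the kernel has constant term iota(0) = 0. *)
Lemma gseries_base_nilpotent : nilpotent_kernel gseries_base.
Proof.
exists n.+1 => x x0; apply: val_inj.
rewrite [LHS](rmorph_prod (val : {rmorphism gseries -> _})) /=.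
rewrite [LHS]surjective_pairing [RHS]surjective_pairing; congr pair.
  rewrite (rmorph_prod (fst : {rmorphism _ -> C})) big_ord_recl.
  by have := x0 ord0; rewrite /= => ->; rewrite mul0r.
rewrite (rmorph_prod (snd : {rmorphism _ -> tps S n})).
apply: prod_tps_eq0 => i.
by rewrite [LHS](coeft_gseries0 (x i)) x0 rmorph0.
Qed.

Section Lift.
Context (X : comPzRingType) (F : {rmorphism X -> C}) (u : {rmorphism X -> tps S n}).

Definition gseries_lift
    (h : forall x, (F x, u x) \in graded_series) (x : X) : gseries :=
  GSeries (h x).

Hypothesis h : forall x, (F x, u x) \in graded_series.

Lemma gseries_lift_additive : zmod_morphism (gseries_lift h).
Proof. by move=> x y; apply: val_inj; rewrite /= !rmorphB. Qed.

Lemma gseries_lift_multiplicative : monoid_morphism (gseries_lift h).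
Proof.
by split=> [|x y]; apply: val_inj; rewrite /= ?(rmorph1 F, rmorph1 u) ?rmorphM.
Qed.

HB.instance Definition _ :=
  GRing.isZmodMorphism.Build X gseries (gseries_lift h) gseries_lift_additive.
HB.instance Definition _ :=
  GRing.isMonoidMorphism.Build X gseries (gseries_lift h)
    gseries_lift_multiplicative.

End Lift.

End GradedSeries.

(** Smoothness lifts the identity of C to the ring of graded series, which is a
    B-algebra through the Taylor homomorphism of d. *)
Lemma higher_derivation_extend_fin (B C S : comPzRingType)
    (g : {rmorphism B -> C}) n (iota : {rmorphism C -> S}) (G : gradation S)
    (d : nat -> B -> S) :
    formally_smooth g -> higher_derivation (Some n) (iota \o g) d ->
    (forall c, G 0 (iota c)) -> (forall i b, (i <= n)%N -> G i (d i b)) ->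
  exists D : nat -> C -> S,
    [/\ higher_derivation (Some n) iota D,
        forall i b, (i <= n)%N -> D i (g b) = d i b
      & forall i c, (i <= n)%N -> G i (D i c)].
Proof.
move=> smooth hd Giota Gd; have [d0 _ _] := hd.
have h b : (g b, taylor hd b) \in graded_series iota G (n := n).
  apply/asboolP; split=> [|i le] /=; rewrite coeft_taylor //.
  exact: Gd.
have [u ug u0] := smooth _ _ (gseries_lift h) g (@gseries_base _ _ iota G n)
  (fun=> erefl) (gseries_base_surj n Giota) (gseries_base_nilpotent iota G n)
  idfun (fun=> erefl).
pose w : {rmorphism C -> tps S n} := @gseries_tps _ _ iota G n \o u.
exists (fun i c => coeft (w c) i); split=> [|i b le|i c le].
- apply: higher_derivation_coeft => c.
  by rewrite [LHS]coeft_gseries0; congr (iota _); exact: u0.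
- by rewrite /w /= ug /= coeft_taylor.
- exact: part_gseries.
Qed.

(** The diagonal of a family of extensions to each finite length; they agree
    where they overlap by uniqueness, which is what makes the diagonal
    multiplicative. *)
Lemma higher_derivation_extend (B C S : comPzRingType)
    (g : {rmorphism B -> C}) m (iota : {rmorphism C -> S}) (G : gradation S)
    (d : nat -> B -> S) :
    formally_etale g -> higher_derivation m (iota \o g) d ->
    (forall c, G 0 (iota c)) -> (forall i b, le_ext i m -> G i (d i b)) ->
  exists D : nat -> C -> S,
    [/\ higher_derivation m iota D,
        forall i b, le_ext i m -> D i (g b) = d i b
      & forall i c, le_ext i m -> G i (D i c)].
Proof.
move=> [unr smooth] hd Giota Gd.
have /choice[E EP] n : exists E : nat -> C -> S, le_ext n m ->
    [/\ higher_derivation (Some n) iota E,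
        forall i b, (i <= n)%N -> E i (g b) = d i b
      & forall i c, (i <= n)%N -> G i (E i c)].
  have [nm|nm] := boolP (le_ext n m); last by exists (fun _ _ => 0).
  have [i b le|E hE] := higher_derivation_extend_fin smooth
    (higher_derivation_le nm hd) Giota; last by exists E.
  by apply: Gd; exact: le_ext_trans nm.
(* Extensions to different lengths have the same components. *)
have EE n i c : le_ext n m -> (i <= n)%N -> E n i c = E i i c.
  move=> nm le; have im := le_ext_trans le nm.
  have [hn gn _] := EP n nm; have [hi gi _] := EP i im.
  apply: (higher_derivation_unique unr _ hi) => //=.
    exact: higher_derivation_le hn.
  by move=> j b ji; rewrite gn ?gi // (leq_trans ji).
exists (fun i => E i i); split=> [|i b im|i c im].
- split=> [c|i im x y|k km x y].
  + have m0 : le_ext 0 m by case: (m).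
    by have [[-> _ _] _ _] := EP 0 m0.
  + by have [[_ ED _] _ _] := EP i im; exact: (ED i (leqnn i)).
  + have [[_ _ EM] _ _] := EP k km; rewrite (EM k (leqnn k)).
    by apply: eq_conv => i ik; rewrite EE.
- by have [_ -> //] := EP i im.
- by have [_ _] := EP i im; exact.
Qed.

(** * The grading of the Hasse-Schmidt algebra *)

Section HomogeneousPolynomials.
Context (X : comPzRingType) (m : option nat).
Local Notation P := (hs_poly X m).
Local Notation weight := (@hs_weight X m).

Definition homogeneous (n : nat) (p : P) : Prop :=
  forall k, k \in msupp (p : {malg X[{cmonom hs_var X m}]}) -> weight k = n.

Local Open Scope fset_scope.

Lemma hs_weightw (d : {fset hs_var X m}) (k : {cmonom hs_var X m}) :
    finsupp k `<=` d ->
  weight k = (\sum_(v <- d) k v * val v.2)%N.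
Proof.
move=> le; rewrite /hs_weight (big_fset_incl _ le) => //= v _.
by rewrite -cmE_eq0 => /eqP ->.
Qed.

Lemma hs_weight1 : weight mone = 0%N.
Proof. by rewrite /hs_weight mdom1 big_seq_fset0. Qed.

Lemma hs_weightM x y : weight (mmul x y) = (weight x + weight y)%N.
Proof.
rewrite (hs_weightw (fsubsetUl (finsupp x) (finsupp y))).
rewrite (hs_weightw (fsubsetUr (finsupp x) (finsupp y))).
rewrite /hs_weight mdomD -big_split /=.
by apply: eq_bigr => v _; rewrite cmM mulnDl.
Qed.

Lemma homogeneousU c k :
  homogeneous (weight k) (<< c *g k >> : {malg X[{cmonom hs_var X m}]}).
Proof. by move=> l /(fsubsetP msuppU_le); rewrite inE => /eqP ->. Qed.

Lemma homogeneous0 n : homogeneous n 0.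
Proof. by move=> k; rewrite msupp0. Qed.

Lemma homogeneousB n p q :
  homogeneous n p -> homogeneous n q -> homogeneous n (p - q).
Proof.
move=> hp hq k /(fsubsetP (msuppB_le _ _)).
by rewrite inE => /orP[/hp|/hq].
Qed.

Lemma homogeneousD n p q :
  homogeneous n p -> homogeneous n q -> homogeneous n (p + q).
Proof.
move=> hp hq k /(fsubsetP (msuppD_le _ _)).
by rewrite inE => /orP[/hp|/hq].
Qed.

Lemma homogeneousM i j p q :
  homogeneous i p -> homogeneous j q -> homogeneous (i + j) (p * q).
Proof.
move=> hp hq; rewrite -[p * q]/(ma_mul _ p q) /ma_mul.
rewrite big_seq; apply: big_ind => [||k kp].
- exact: homogeneous0.
- exact: homogeneousD.
rewrite big_seq; apply: big_ind => [||l lq].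
- exact: homogeneous0.
- exact: homogeneousD.
by rewrite -(hp k kp) -(hq l lq) -hs_weightM; exact: homogeneousU.
Qed.

(** Arbitrary exponents e, rather than those of a given monomial, make an
    induction on r possible. *)
Lemma ma_mon_prod (r : seq (hs_var X m)) (e : hs_var X m -> nat) :
  exists2 q : {cmonom hs_var X m},
    \prod_(v <- r) ma_mon X (@mmul {cmonom hs_var X m}) (ucm v) ^+ e v
      = ma_mon X _ q
    & forall w, q w = (\sum_(v <- r) (v == w) * e v)%N.
Proof.
have monM x y : ma_mon X (@mmul {cmonom hs_var X m}) x * ma_mon X _ y
    = ma_mon X _ (mmul x y).
  by rewrite !ma_monE -[LHS]/(ma_mul _ _ _) ma_mulUU mulr1.
have mon1 : 1 = ma_mon X (@mmul {cmonom hs_var X m}) mone.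
  by rewrite ma_monE.
have monX v n : exists2 q : {cmonom hs_var X m},
    ma_mon X (@mmul {cmonom hs_var X m}) (ucm v) ^+ n = ma_mon X _ q
    & forall w, q w = ((v == w) * n)%N.
  elim: n => [|n [q qE qw]].
    by exists mone => [|w]; rewrite ?expr0 // cm1 muln0.
  exists (mmul (ucm v) q) => [|w]; first by rewrite exprS qE monM.
  by rewrite cmM cmU qw mulnS.
elim: r => [|v r [q qE qw]].
  by exists mone => [|w]; rewrite big_nil // cm1.
have [q' q'E q'w] := monX v (e v).
exists (mmul q' q) => [|w]; first by rewrite big_cons qE q'E monM.
by rewrite big_cons cmM q'w qw.
Qed.

Lemma ma_mon_var (k : {cmonom hs_var X m}) :
  ma_mon X (@mmul {cmonom hs_var X m}) k
  = \prod_(v <- finsupp k) ma_mon X _ (ucm v) ^+ k v.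
Proof.
have [q -> qw] := ma_mon_prod (finsupp k) k; congr ma_mon.
apply/eqP/cmP => w; rewrite qw.
have [wk|wk] := boolP (w \in finsupp k).
  rewrite (big_fsetD1 w) //= eqxx mul1n big_seq big1 ?addn0 // => v.
  by rewrite !inE => /andP[/negbTE -> _].
rewrite big_seq big1; first by apply/eqP; rewrite cmE_eq0.
by move=> v vk; case: eqP vk wk => // -> ->.
Qed.

End HomogeneousPolynomials.

Section HSStructure.
Context (A X : comPzRingType) (f : {rmorphism A -> X}) (m : option nat).
Local Notation H := (HS f m).

Lemma higher_derivation_hs : higher_derivation m (hs_in f m) (hs_d f m).
Proof.
by split=> [|i im x y|k km x y] //; [exact: hs_dD|exact: hs_dM].
Qed.

Lemma hs_var_le (v : hs_var X m) : le_ext (val v.2) m.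
Proof. by case: v => x [i /= /andP[]]. Qed.

Lemma hs_d_var (v : hs_var X m) :
  qpi (@hs_rel A X f m) (ma_mon X _ (ucm v)) = hs_d f m (val v.2) v.1.
Proof.
case: v => x j; rewrite /hs_d /hs_sym /=.
have /andP[j0 _] := valP j.
by rewrite -(negbK (val j == 0)) -lt0n j0 /= valK.
Qed.

Lemma hs_monomial (c : X) (k : {cmonom hs_var X m}) :
  qpi (@hs_rel A X f m) (<< c *g k >> : {malg X[{cmonom hs_var X m}]})
  = hs_in f m c * \prod_(v <- finsupp k) hs_d f m (val v.2) v.1 ^+ k v.
Proof.
have -> : (<< c *g k >> : {malg X[{cmonom hs_var X m}]})
    = ma_const _ c * ma_mon X (@mmul {cmonom hs_var X m}) k
      :> hs_poly X m.
  rewrite ma_constE ma_monE -[RHS]/(ma_mul _ _ _) ma_mulUU mulr1.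
  by rewrite Monoid.mul1m.
rewrite rmorphM; congr (_ * _); rewrite ma_mon_var rmorph_prod.
by apply: eq_bigr => v _; rewrite rmorphXn -hs_d_var.
Qed.

(** This reduces statements about homomorphisms out of the Hasse-Schmidt algebra
    to the values they take on the d_i x. *)
Lemma hs_expand (p : hs_poly X m) :
  qpi (@hs_rel A X f m) p
  = \sum_(k <- msupp (p : {malg X[{cmonom hs_var X m}]}))
      hs_in f m (mcoeff k p)
      * \prod_(v <- finsupp k) hs_d f m (val v.2) v.1 ^+ k v.
Proof.
rewrite {1}[p]monalgE rmorph_sum.
by apply: eq_bigr => k _; exact: hs_monomial.
Qed.

Lemma hs_hom_eq (S : comPzRingType) (phi psi : {rmorphism H -> S}) :
    (forall i x, le_ext i m -> phi (hs_d f m i x) = psi (hs_d f m i x)) ->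
  phi =1 psi.
Proof.
move=> e h; rewrite -[h]qreprK hs_expand !rmorph_sum; apply: eq_bigr => k _.
rewrite !rmorphM !rmorph_prod; congr (_ * _).
  by apply: (e 0%N); case: (m).
by apply: eq_bigr => v _; rewrite !rmorphXn e // hs_var_le.
Qed.

Lemma hs_hom_deg (S : comPzRingType) (G : gradation S)
    (phi : {rmorphism H -> S}) :
    (forall i x, le_ext i m -> G i (phi (hs_d f m i x))) ->
  forall n h, hs_deg n h -> G n (phi h).
Proof.
move=> Gd n _ [p hp ->]; rewrite hs_expand rmorph_sum.
apply: part_sum => k kp _; rewrite rmorphM rmorph_prod -(hp k kp).
rewrite -[hs_weight k]add0n; apply: partM; first by apply: (Gd 0%N); case: (m).
apply: part_prod => v; rewrite rmorphXn; apply: partX.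
exact/Gd/hs_var_le.
Qed.

Lemma hs_deg0 n : hs_deg n (0 : H).
Proof. by exists 0; [exact: homogeneous0|rewrite rmorph0]. Qed.

Lemma hs_degB n (x y : H) : hs_deg n x -> hs_deg n y -> hs_deg n (x - y).
Proof.
move=> [p hp ->] [q hq ->]; exists (p - q); last by rewrite rmorphB.
exact: homogeneousB.
Qed.

Lemma hs_deg1 : hs_deg 0 (1 : H).
Proof.
exists 1; last by rewrite rmorph1.
by rewrite -(hs_weight1 X m); exact: homogeneousU.
Qed.

Lemma hs_degM i j (x y : H) :
  hs_deg i x -> hs_deg j y -> hs_deg (i + j) (x * y).
Proof.
move=> [p hp ->] [q hq ->]; exists (p * q); last by rewrite rmorphM.
exact: homogeneousM.
Qed.

Definition hs_gradation : gradation H :=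
  Gradation hs_deg0 hs_degB hs_deg1 hs_degM.

Lemma hs_deg_d i x : le_ext i m -> hs_deg i (hs_d f m i x).
Proof.
move=> im; rewrite /hs_d /hs_sym; case: eqP => [->|/eqP i0].
  exists (ma_const _ x) => //; rewrite -(hs_weight1 X m) ma_constE.
  exact: homogeneousU.
rewrite insubT ?lt0n ?i0 //= => ij.
eexists; last by [].
move=> k; rewrite ma_monE => /homogeneousU ->.
by rewrite /hs_weight mdomU big_seq_fset1 cmUU mul1n.
Qed.

End HSStructure.

(** * Tensor products *)

Section TensorStructure.
Context (B R C : comPzRingType).
Context (r : {rmorphism B -> R}) (g : {rmorphism B -> C}).
Local Notation T := (tensor r g).

Definition tensor_inl (x : R) : T := tens r g x 1.

Lemma tensor_inl_additive : zmod_morphism tensor_inl.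
Proof.
move=> x y; apply/eqP; rewrite eq_sym subr_eq /tensor_inl -tensDl.
by rewrite subrK.
Qed.

Lemma tensor_inl_multiplicative : monoid_morphism tensor_inl.
Proof. by split=> [|x y]; rewrite /tensor_inl ?tens1 // -tensM mul1r. Qed.

HB.instance Definition _ :=
  GRing.isZmodMorphism.Build R T tensor_inl tensor_inl_additive.
HB.instance Definition _ :=
  GRing.isMonoidMorphism.Build R T tensor_inl tensor_inl_multiplicative.

Lemma tens_split x y : tens r g x y = tensor_inl x * tensor_in r g y.
Proof. by rewrite -tensM mulr1 mul1r. Qed.

Lemma tensNl x y : tens r g (- x) y = - tens r g x y.
Proof. by rewrite !tens_split rmorphN mulNr. Qed.

Lemma tensor_inl_base b : tensor_inl (r b) = tensor_in r g (g b).
Proof. by rewrite /tensor_inl -[r b]mulr1 tensB mulr1. Qed.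

(** An integer coefficient is absorbed into the first tensor factor. *)
Lemma tensor_span (t : T) :
  exists s : seq (R * C), t = \sum_(q <- s) tens r g q.1 q.2.
Proof.
pose zc (z : int) (q : R * C) := (z%:~R * q.1, q.2).
rewrite -[t]qreprK; set p := qrepr t.
exists [seq zc (mcoeff k p) k | k <- msupp (p : {malg int[(R * C)%type]})].
rewrite {1}[p]monalgE rmorph_sum big_map; apply: eq_bigr => -[x y] _ /=.
set z := mcoeff _ _.
have -> : (<< z *g (x, y) >> : {malg int[(R * C)%type]})
    = ma_const _ z * tensor_sym x y :> tensor_pre R C.
  rewrite ma_constE /tensor_sym ma_monE -[RHS]/(ma_mul _ _ _) ma_mulUU mulr1.
  by rewrite Monoid.mul1m.
rewrite -[z]intz !rmorphM rmorph_int rmorph_int tens_split rmorphM rmorph_int.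
by rewrite -mulrA -tens_split rmorph_int.
Qed.

Lemma tensor_hom_eq (S : comPzRingType) (phi psi : {rmorphism T -> S}) :
    (forall x, phi (tensor_inl x) = psi (tensor_inl x)) ->
    (forall y, phi (tensor_in r g y) = psi (tensor_in r g y)) ->
  phi =1 psi.
Proof.
move=> el er t; have [s ->] := tensor_span t.
rewrite !rmorph_sum; apply: eq_bigr => q _.
by rewrite tens_split !rmorphM el er.
Qed.

Section Grading.
Variable G : gradation R.

Lemma tensor_deg0 n : tensor_deg G n (0 : T).
Proof. by exists [::] => //; rewrite big_nil. Qed.

Lemma tensor_degD n (x y : T) :
  tensor_deg G n x -> tensor_deg G n y -> tensor_deg G n (x + y).
Proof.
move=> [s hs ->] [t ht ->]; exists (s ++ t); last by rewrite big_cat.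
by move=> q; rewrite mem_cat => /orP[/hs|/ht].
Qed.

Lemma tensor_deg_tens n x y : G n x -> tensor_deg G n (tens r g x y).
Proof.
move=> Gx; exists [:: (x, y)]; last by rewrite big_seq1.
by move=> q; rewrite inE => /eqP ->.
Qed.

Lemma tensor_deg_sum n (I : eqType) (s : seq I) (F : I -> T) :
  (forall i, i \in s -> tensor_deg G n (F i)) ->
  tensor_deg G n (\sum_(i <- s) F i).
Proof.
move=> GF; rewrite big_seq; apply: big_ind => //; first exact: tensor_deg0.
exact: tensor_degD.
Qed.

Lemma tensor_degB n (x y : T) :
  tensor_deg G n x -> tensor_deg G n y -> tensor_deg G n (x - y).
Proof.
move=> hx [t ht ->]; apply: tensor_degD => //; rewrite -sumrN.
apply: tensor_deg_sum => q /ht Gq; rewrite -tensNl; apply: tensor_deg_tens.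
by rewrite -sub0r; apply: partB => //; exact: part0.
Qed.

Lemma tensor_deg1 : tensor_deg G 0 (1 : T).
Proof. by rewrite -(tens1 r g); apply/tensor_deg_tens/part1. Qed.

Lemma tensor_degM i j (x y : T) :
  tensor_deg G i x -> tensor_deg G j y -> tensor_deg G (i + j) (x * y).
Proof.
move=> [s hs ->] [t ht ->]; rewrite mulr_suml; apply: tensor_deg_sum => q qs.
rewrite mulr_sumr; apply: tensor_deg_sum => q' q't.
by rewrite -tensM; apply/tensor_deg_tens/partM; [exact: hs|exact: ht].
Qed.

Definition tensor_gradation : gradation T :=
  Gradation tensor_deg0 tensor_degB tensor_deg1 tensor_degM.

End Grading.
End TensorStructure.

(** * Formally etale base change *)

Section BaseChange.
Context (A B C : comPzRingType) (f : {rmorphism A -> B}).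
Context (g : {rmorphism B -> C}) (m : option nat).
Local Notation gf := (comp_rmorphism f g).
Local Notation T := (tensor (hs_in f m) g).
Local Notation inH := (tensor_inl (hs_in f m) g).
Local Notation inC := (tensor_in (hs_in f m) g).

Lemma natural_map_inl h : natural_map f g m (inH h) = hs_map f g m h.
Proof. by rewrite [LHS](tensor_liftE (hs_map_in f g m)) rmorph1 mulr1. Qed.

Lemma natural_map_inr c : natural_map f g m (inC c) = hs_in gf m c.
Proof. by rewrite [LHS](tensor_liftE (hs_map_in f g m)) rmorph1 mul1r. Qed.

Lemma natural_map_deg n t :
  tensor_deg (hs_deg (m := m)) n t -> hs_deg n (natural_map f g m t).
Proof.
move=> [s hs ->]; rewrite rmorph_sum.
apply: (part_sum (G := hs_gradation gf m)) => q qs _.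
rewrite tens_split rmorphM natural_map_inl natural_map_inr -[n]addn0.
apply: (partM (g := hs_gradation gf m)).
  apply: (hs_hom_deg (G := hs_gradation gf m)) (hs _ qs) => i x im.
  by rewrite hs_map_d //; exact: hs_deg_d.
by rewrite -hs_d0; apply: hs_deg_d; case: (m).
Qed.

(** The universal higher derivation of B, pushed to the tensor product, agrees
    with C in degree 0 because of the relation b (x) 1 = 1 (x) b. *)
Lemma universal_higher_derivation_extends : formally_etale g ->
  exists D : nat -> C -> T,
    [/\ higher_derivation m inC D,
        forall i b, le_ext i m -> D i (g b) = inH (hs_d f m i b)
      & forall i c, le_ext i m -> tensor_deg (hs_deg (m := m)) i (D i c)].
Proof.
move=> et.
pose G := tensor_gradation (hs_in f m) g (hs_gradation f m).
apply: (higher_derivation_extend (G := G) et) => [|c|i b im].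
- have [D0 DD DM] := higher_derivation_comp inH (higher_derivation_hs f m).
  by split=> // b; exact: tensor_inl_base.
- by apply: tensor_deg_tens; exact: hs_deg1.
- by apply: tensor_deg_tens; exact: hs_deg_d.
Qed.

(** The inverse classifies the extension of the universal higher derivation of B
    to C. *)
Lemma natural_map_inverse : formally_etale g ->
  exists psi : {rmorphism HS gf m -> T},
    [/\ cancel (natural_map f g m) psi, cancel psi (natural_map f g m)
      & forall n y, hs_deg n y -> tensor_deg (hs_deg (m := m)) n (psi y)].
Proof.
move=> et; have [unr _] := et.
have [D [hD Dg Ddeg]] := universal_higher_derivation_extends et.
have [D0 DD DM] := hD.
have DA a i : (0 < i)%N -> le_ext i m -> D i (gf a) = 0.
  by move=> i0 im; rewrite /= Dg // hs_dA // rmorph0.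
pose psi : {rmorphism HS gf m -> T} :=
  hs_lift D0 (fun x y i _ im => DD i im x y) DA (fun x y k km => DM k km x y).
have psid i c : le_ext i m -> psi (hs_d gf m i c) = D i c.
  exact: hs_lift_d.
exists psi; split=> [t|y|n y].
- apply: (tensor_hom_eq (phi := psi \o natural_map f g m) (psi := idfun)).
    move=> h /=; rewrite natural_map_inl; move: h.
    apply: (hs_hom_eq (phi := psi \o hs_map f g m) (psi := inH)) => i x im.
    by rewrite /= hs_map_d // psid // Dg.
  move=> c /=; rewrite natural_map_inr -hs_d0 psid ?D0 //.
  by case: (m).
- apply: (hs_hom_eq (phi := natural_map f g m \o psi) (psi := idfun)).
  move=> i x im; rewrite /= psid //; move: i x im.
  (* Both sides are extensions of the same higher derivation of B. *)
  have hphiD : higher_derivation m (hs_in gf m)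
      (fun i => natural_map f g m \o D i).
    have [E0 ED EM] := higher_derivation_comp (natural_map f g m) hD.
    by split=> // c; rewrite E0; exact: natural_map_inr.
  apply: (higher_derivation_unique unr hphiD (higher_derivation_hs gf m)).
  by move=> i b im; rewrite /= Dg // natural_map_inl hs_map_d.
- apply: (hs_hom_deg (G := tensor_gradation _ g (hs_gradation f m))) => i c im.
  by rewrite psid //; exact: Ddeg.
Qed.

End BaseChange.

Theorem theorem3p6 (A B C : comPzRingType)
    (f : {rmorphism A -> B}) (g : {rmorphism B -> C}) (m : option nat) :
  formally_etale g ->
  graded_alg_iso
    (tensor_in (hs_in f m) g) (tensor_deg (hs_deg (m := m)))
    (hs_in (comp_rmorphism f g) m) (hs_deg (m := m))
    (natural_map f g m).
Proof.
move=> et; have [psi [phiK psiK psi_deg]] := natural_map_inverse f m et.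
split; first by exists psi.
- exact: natural_map_inr.
- move=> n t; split; first exact: natural_map_deg.
  by move=> /psi_deg; rewrite phiK.
Qed.
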